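(* Let $k\ge 3$ be an integer, let $a\ge 0$, and let $F:\mathcal{Q}^+\to\mathcal{Q}^+$ be the $k$-dimensional Lyness' map $$F(x_1,\ldots,x_k)=\left(x_2,\ldots,x_k,\frac{a+\sum_{i=2}^{k}x_i}{x_1}\right).$$ Then the vector field $\mathbf{X}_k=\sum_{i=1}^{k}X_i\,\frac{\partial}{\partial x_i}$ is a Lie symmetry of $F$, where $$X_1(\mathbf{x})=\frac{(x_1+1)\left[\prod_{i=2}^{k-1}(1+x_i+x_{i+1})\right]\left(a+\sum_{i=1}^{k-1}x_i-x_2x_k\right)}{\prod_{i=2}^{k}x_i},$$ $$X_m(\mathbf{x})=\frac{(x_m+1)\left[\prod_{i=1,\,i\neq m-1,m}^{k-1}(1+x_i+x_{i+1})\right]\left(a+\sum_{i=1}^{k}x_i+x_1x_k\right)(x_{m-1}-x_{m+1})}{\prod_{i=1,\,i\neq m}^{k}x_i}\quad\text{for all } 2\le m\le k-1,$$ $$X_k(\mathbf{x})=-\frac{(x_k+1)\left[\prod_{i=1}^{k-2}(1+x_i+x_{i+1})\right]\left(a+\sum_{i=2}^{k}x_i-x_1x_{k-1}\right)}{\prod_{i=1}^{k-1}x_i}.$$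
   Context: $\mathcal{Q}^+=\{\mathbf{x}=(x_1,\ldots,x_k)\in\mathbb{R}^k : x_1>0,\ldots,x_k>0\}$; the Lyness' map $F$ is a diffeomorphism of $\mathcal{Q}^+$ onto itself. A vector field $\mathbf{X}$ is a Lie symmetry of a map $G$ if $\mathbf{X}(G(\mathbf{x}))=(DG(\mathbf{x}))\,\mathbf{X}(\mathbf{x})$ for all $\mathbf{x}$ in the domain, where $DG(\mathbf{x})$ is the Jacobian matrix of $G$ at $\mathbf{x}$ and $\mathbf{X}$ is regarded as the column vector of its components. Empty products are equal to $1$. *)

(* Defs.v *)
From mathcomp Require Import all_boot all_order all_algebra.
From mathcomp Require Import all_classical all_reals all_analysis.

Set Implicit Arguments.
Unset Strict Implicit.
Unset Printing Implicit Defensive.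

Import Order.TTheory GRing.Theory Num.Theory.
Import numFieldNormedType.Exports.

Local Open Scope classical_set_scope.
Local Open Scope ring_scope.

(* Points of R^k are row vectors, whose library indices run from 0 to k-1;
   [coord x i] is the i-th coordinate counted from 1, and 0 when i is not in
   1..k. *)
Definition coord (R : realType) (k : nat) (x : 'rV[R]_k) (i : nat) : R :=
  if i is j.+1 then oapp (x ord0) 0 (insub j) else 0.

Definition positive_orthant (R : realType) (k : nat) : set 'rV[R]_k :=
  [set x | forall i : 'I_k, 0 < x ord0 i].
Arguments positive_orthant : clear implicits.

(* The library's ['J G x] acts on row vectors from the right; its transpose
   has (i, j) entry dG_i/dx_j. *)
Definition jacobian_matrix (R : realType) (k : nat) (G : 'rV[R]_k -> 'rV[R]_k)
    (x : 'rV[R]_k) : 'M[R]_k :=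
  ('J G x)^T.

(* The first two clauses say that G is a differentiable self-map of U; the
   differential of a function that is not differentiable is a meaningless
   default value. U is meant to be open, so that only the values of G on U
   matter. *)
Definition lie_symmetry (R : realType) (k : nat) (U : set 'rV[R]_k)
    (G X : 'rV[R]_k -> 'rV[R]_k) : Prop :=
  [/\ forall x, U x -> U (G x),
      forall x, U x -> differentiable G x
    & forall x, U x -> (X (G x))^T = jacobian_matrix G x *m (X x)^T].

Definition lyness (R : realType) (k : nat) (a : R) (x : 'rV[R]_k) : 'rV[R]_k :=
  let x_ := coord x in
  \row_(i < k)
    if (i.+1 < k)%N then x_ i.+2
    else (a + \sum_(2 <= j < k.+1) x_ j) / x_ 1%N.

Definition lyness_X1 (R : realType) (k : nat) (a : R) (x : 'rV[R]_k) : R :=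
  let x_ := coord x in
  (x_ 1%N + 1) * (\prod_(2 <= i < k) (1 + x_ i + x_ i.+1))
    * (a + \sum_(1 <= i < k) x_ i - x_ 2%N * x_ k)
  / \prod_(2 <= i < k.+1) x_ i.

Definition lyness_Xm (R : realType) (k : nat) (a : R) (m : nat)
    (x : 'rV[R]_k) : R :=
  let x_ := coord x in
  (x_ m + 1)
    * (\prod_(1 <= i < k | (i != m.-1) && (i != m)) (1 + x_ i + x_ i.+1))
    * (a + \sum_(1 <= i < k.+1) x_ i + x_ 1%N * x_ k)
    * (x_ m.-1 - x_ m.+1)
  / \prod_(1 <= i < k.+1 | i != m) x_ i.

Definition lyness_Xk (R : realType) (k : nat) (a : R) (x : 'rV[R]_k) : R :=
  let x_ := coord x in
  - ((x_ k + 1) * (\prod_(1 <= i < k.-1) (1 + x_ i + x_ i.+1))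
      * (a + \sum_(2 <= i < k.+1) x_ i - x_ 1%N * x_ k.-1)
    / \prod_(1 <= i < k) x_ i).

Definition lyness_field (R : realType) (k : nat) (a : R) (x : 'rV[R]_k) :
    'rV[R]_k :=
  \row_(i < k)
    if i.+1 == 1%N then lyness_X1 a x
    else if i.+1 == k then lyness_Xk a x
    else lyness_Xm a i.+1 x.

(* Main.v *)
Require Import Defs.
From mathcomp Require Import all_boot all_order all_algebra.
From mathcomp Require Import all_classical all_reals all_analysis.
From HB Require Import structures.
From mathcomp Require Import ring lra zify.
Import Order.TTheory GRing.Theory Num.Theory.
Import numFieldNormedType.Exports.
Local Open Scope ring_scope.

(** Extend a point [x] of the positive orthant to the stretch
    [s 0, s 1, ..., s k.+2] of its orbit: the coordinates of [x] are
    [s 1, ..., s k], and [s n * s (n + k) = a + s n.+1 + ... + s (n + k).-1] for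
    [n = 0, 1, 2]. Then [lyness a] is the shift of [s]. Write
    [p i = 1 + s i + s i.+1].

    Subtracting two consecutive relations gives
    [s n.+1 * p (n + k) = s (n + k) * p n] ([consecutive_sum_exchange]), and
    therefore [V = (p 1 * ... * p k) / (s 2 * ... * s k)] is invariant under the
    shift ([invariant_shift]). All three formulas for the components of the
    field reduce to the single formula [X_i = V * g i], where
    [g i = s i * (1 + s i) * (s i.-1 - s i.+1) / (p i.-1 * p i)]
    ([lyness_field_window]).

    So the field at the image point is the shift of the field at [x], namely
    [V *: (g 2, ..., g k.+1)]. On the other hand the differential of the map
    shifts a tangent vector and computes the new last entry from the linearised
    recurrence. The symmetry thus amounts to the statement that [g] satisfies
    the linearised recurrence
    [s 1 * g k.+1 + s k.+1 * g 1 = g 2 + ... + g k] ([linearized_relation]). The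
    sum on the right telescopes, because [g i = h i.-1 - h i] with
    [h i = s i * s i.+1 / p i] ([directionE]), and what remains is a rational
    identity modulo the exchange relations. *)

Set Implicit Arguments.
Unset Strict Implicit.
Unset Printing Implicit Defensive.

(** * Sequences satisfying the Lyness recurrence *)

(** The point of R^k with coordinates [s 1, ..., s k]; [s 0] is the entry
    preceding them. *)
Definition window (R : realType) (k : nat) (s : nat -> R) : 'rV[R]_k :=
  \row_(i < k) s i.+1.

Definition seq_shift (R : realType) (s : nat -> R) : nat -> R :=
  fun i => s i.+1.

(** The Lyness recurrence at index [n], written without division. *)
Definition lyness_relation (R : realType) (k : nat) (a : R) (s : nat -> R)
    (n : nat) : Prop :=
  s n * s (n + k)%N = a + \sum_(n.+1 <= j < n + k) s j.

Definition consecutive_sum (R : realType) (s : nat -> R) (i : nat) : R :=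
  1 + s i + s i.+1.

(** The [i]-th component of the symmetry, up to a factor independent of [i]. It
    involves [s i.-1], hence [s 0] when [i] is 1. *)
Definition direction (R : realType) (s : nat -> R) (i : nat) : R :=
  s i * (1 + s i) * (s i.-1 - s i.+1)
  / (consecutive_sum s i.-1 * consecutive_sum s i).

(** A discrete primitive of [direction], up to sign. *)
Definition potential (R : realType) (s : nat -> R) (i : nat) : R :=
  s i * s i.+1 / consecutive_sum s i.

(** A first integral of the Lyness recurrence. The factor [p k] of the numerator
    involves [s k.+1], that is, the last coordinate of the image point. *)
Definition invariant (R : realType) (k : nat) (s : nat -> R) : R :=
  (\prod_(1 <= i < k.+1) consecutive_sum s i) / \prod_(2 <= i < k.+1) s i.

Section LynessSequences.
Variables (R : realType) (k : nat) (a : R).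
Hypothesis hk : (3 <= k)%N.
Implicit Types (s : nat -> R) (i m n : nat).

Lemma coord_window s i : (0 < i <= k)%N -> Defs.coord (window k s) i = s i.
Proof.
by case: i => // i /= ik; rewrite /Defs.coord insubT /= mxE.
Qed.

Lemma sum_window s m n : (0 < m)%N -> (n <= k.+1)%N ->
  \sum_(m <= i < n) Defs.coord (window k s) i = \sum_(m <= i < n) s i.
Proof.
by move=> m0 nk; apply: eq_big_nat => i ik; rewrite coord_window //; lia.
Qed.

Lemma prod_window s m n : (0 < m)%N -> (n <= k.+1)%N ->
  \prod_(m <= i < n) Defs.coord (window k s) i = \prod_(m <= i < n) s i.
Proof.
by move=> m0 nk; apply: eq_big_nat => i ik; rewrite coord_window //; lia.
Qed.

Lemma prod_consecutive_window s m n : (0 < m)%N -> (n <= k)%N ->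
  \prod_(m <= i < n)
     (1 + Defs.coord (window k s) i + Defs.coord (window k s) i.+1)
  = \prod_(m <= i < n) consecutive_sum s i.
Proof.
by move=> m0 nk; apply: eq_big_nat => i ik; rewrite !coord_window //; lia.
Qed.

Lemma prod_nat_neq0 s m n : (forall i, (m <= i < n)%N -> 0 < s i) ->
  \prod_(m <= i < n) s i != 0.
Proof.
move=> s_gt0; rewrite big_nat prodf_seq_neq0; apply/allP => i _.
by apply/implyP => ik; rewrite gt_eqF ?s_gt0.
Qed.

Lemma consecutive_sum_gt0 s i : 0 < s i -> 0 < s i.+1 ->
  0 < consecutive_sum s i.
Proof. by rewrite /consecutive_sum => *; rewrite !addr_gt0. Qed.

Lemma lyness_relation_exchange s n :
  lyness_relation k a s n -> lyness_relation k a s n.+1 ->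
  s n.+1 * (1 + s (n + k).+1) = s (n + k)%N * (1 + s n).
Proof.
rewrite /lyness_relation addSn => h0 h1.
have nk : (n.+1 < n + k)%N by lia.
have n2 : (n.+2 <= n + k)%N by lia.
rewrite mulrDr h1 big_nat_recr //= [in RHS]mulrDr [_ * s n]mulrC h0.
by rewrite [in RHS]big_ltn //; ring.
Qed.

(** In this form a single monomial is exchanged for another, which is what makes
    [invariant] shift-invariant. *)
Lemma consecutive_sum_exchange s n :
  lyness_relation k a s n -> lyness_relation k a s n.+1 ->
  s n.+1 * consecutive_sum s (n + k)%N = s (n + k)%N * consecutive_sum s n.
Proof.
move=> h0 h1; have := lyness_relation_exchange h0 h1.
by rewrite /consecutive_sum => e; lra.
Qed.

Lemma lyness_relation_shift s n :
  lyness_relation k a s n.+1 -> lyness_relation k a (seq_shift s) n.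
Proof. by rewrite /lyness_relation /seq_shift addSn big_add1. Qed.

Lemma invariant_shift s :
  (forall i, (i <= k.+2)%N -> 0 < s i) ->
  lyness_relation k a s 1 -> lyness_relation k a s 2 ->
  invariant k (seq_shift s) = invariant k s.
Proof.
move=> s_gt0 h1 h2.
have e : s 2%N * consecutive_sum s k.+1 = s k.+1 * consecutive_sum s 1%N.
  exact: (consecutive_sum_exchange h1 h2).
rewrite /invariant.
have -> : \prod_(1 <= i < k.+1) consecutive_sum (seq_shift s) i
   = \prod_(2 <= i < k.+2) consecutive_sum s i by rewrite [RHS]big_add1.
have -> : \prod_(2 <= i < k.+1) seq_shift s i = \prod_(3 <= i < k.+2) s i.
  by rewrite [RHS]big_add1.
have k2 : (2 <= k.+1)%N by lia.
rewrite big_nat_recr //= [in X in _ = X / _]big_ltn; last by lia.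
rewrite [in X in _ = _ / X]big_ltn; last by lia.
rewrite [in X in _ / X = _]big_nat_recr //=; last by lia.
set P := \prod_(_ <= _ < _) _; set Q := \prod_(_ <= _ < _) _.
have Q0 : Q != 0 by apply: prod_nat_neq0 => i ik; apply: s_gt0; lia.
have s20 : s 2%N != 0 by rewrite gt_eqF // s_gt0 //; lia.
have sk0 : s k.+1 != 0 by rewrite gt_eqF // s_gt0 //; lia.
apply/eqP; rewrite eqr_div ?mulf_neq0 //; apply/eqP.
by ring: e.
Qed.

Lemma directionE s i : (0 < i)%N ->
  consecutive_sum s i.-1 != 0 -> consecutive_sum s i != 0 ->
  direction s i = potential s i.-1 - potential s i.
Proof.
case: i => // i _; rewrite /direction /potential /consecutive_sum /= => p0 p1.
by field; rewrite p0 p1.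
Qed.

Lemma sum_direction s : (forall i, (i <= k.+1)%N -> 0 < s i) ->
  \sum_(2 <= i < k.+1) direction s i = potential s 1 - potential s k.
Proof.
move=> s_gt0.
have -> : potential s 1 - potential s k = - (potential s k - potential s 1).
  by rewrite opprB.
rewrite -(telescope_sumr (potential s)); last by lia.
rewrite big_add1 -sumrN big_nat [RHS]big_nat; apply: eq_bigr => i ik.
by rewrite opprB directionE //= gt_eqF // consecutive_sum_gt0 ?s_gt0 //; lia.
Qed.

(** [direction s] solves the linearisation of the relation
    [s 1 * s k.+1 = a + s 2 + ... + s k] along the sequence [s]. *)
Lemma linearized_relation s :
  (forall i, (i <= k.+2)%N -> 0 < s i) ->
  lyness_relation k a s 0 -> lyness_relation k a s 1 ->
  lyness_relation k a s 2 ->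
  s 1%N * direction s k.+1 + s k.+1 * direction s 1
  = \sum_(2 <= i < k.+1) direction s i.
Proof.
move=> s_gt0 h0 h1 h2; rewrite sum_direction; last first.
  by move=> i ik; apply: s_gt0; lia.
have p0 i : (i <= k.+1)%N -> consecutive_sum s i != 0.
  by move=> ik; rewrite gt_eqF // consecutive_sum_gt0 ?s_gt0 //; lia.
have e1 := lyness_relation_exchange h0 h1.
have e2 := lyness_relation_exchange h1 h2.
have f1 := consecutive_sum_exchange h0 h1.
have f2 := consecutive_sum_exchange h1 h2.
rewrite add0n add1n in e1 e2 f1 f2.
(* The exchange relations express both extreme terms over the common
   denominator [p k * p 1] of the telescoped sum, without [s 0] and [s k.+2]. *)
have -> : direction s 1
    = (1 + s 1%N) * (s 1%N * (1 + s k.+1) - s k * (1 + s 2%N))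
    / (consecutive_sum s k * consecutive_sum s 1).
  rewrite /direction /= e1.
  apply/eqP; rewrite eqr_div ?mulf_neq0 ?p0 //.
  by apply/eqP; ring: f1.
have -> : direction s k.+1
    = (1 + s k.+1) * (s 2%N * (1 + s k) - s k.+1 * (1 + s 1%N))
    / (consecutive_sum s k * consecutive_sum s 1).
  rewrite /direction /= -e2.
  apply/eqP; rewrite eqr_div ?mulf_neq0 ?p0 //.
  by apply/eqP; ring: f2.
rewrite /potential.
have := p0 1%N isT; have : consecutive_sum s k != 0 by rewrite p0.
rewrite /consecutive_sum => pk p1.
by field; rewrite pk p1.
Qed.

(** * The field along a sequence *)

Lemma lyness_X1_window s :
  (forall i, (i <= k.+1)%N -> 0 < s i) ->
  lyness_relation k a s 0 -> lyness_relation k a s 1 ->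
  lyness_X1 a (window k s) = invariant k s * direction s 1.
Proof.
move=> s_gt0 h0 h1.
have f := consecutive_sum_exchange h0 h1; rewrite add0n in f.
have p0 i : (i <= k)%N -> consecutive_sum s i != 0.
  by move=> ik; rewrite gt_eqF // consecutive_sum_gt0 ?s_gt0 //; lia.
rewrite /lyness_X1 /invariant /direction; cbv zeta.
rewrite !coord_window; [|lia..].
rewrite sum_window ?prod_window ?prod_consecutive_window //.
(* The third factor of the numerator is [s k * (s 0 - s 2)]. *)
move: (h0); rewrite /lyness_relation add0n /= => <-.
have eP : \prod_(1 <= i < k.+1) consecutive_sum s i
  = consecutive_sum s 1 * \prod_(2 <= i < k) consecutive_sum s i
    * consecutive_sum s k.
  rewrite big_nat_recr /=; last by lia.
  by rewrite big_ltn //; lia.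
rewrite eP.
have Q0 : \prod_(2 <= i < k.+1) s i != 0.
  by apply: prod_nat_neq0 => i ik; apply: s_gt0; lia.
move: Q0.
set P := \prod_(_ <= _ < _) _; set Q := \prod_(_ <= _ < _) _ => Q0.
have p00 : consecutive_sum s 0 != 0 by rewrite p0.
have p10 : consecutive_sum s 1 != 0 by rewrite p0 //; lia.
rewrite mulf_div; apply/eqP; rewrite eqr_div ?mulf_neq0 //; apply/eqP.
by ring: f.
Qed.

Lemma lyness_Xm_window s m : (1 < m < k)%N ->
  (forall i, (i <= k.+1)%N -> 0 < s i) -> lyness_relation k a s 1 ->
  lyness_Xm a m (window k s) = invariant k s * direction s m.
Proof.
move=> mk s_gt0 h1.
have p0 i : (i <= k)%N -> consecutive_sum s i != 0.
  by move=> ik; rewrite gt_eqF // consecutive_sum_gt0 ?s_gt0 //; lia.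
have s0 i : (i <= k)%N -> s i != 0 by move=> ?; rewrite gt_eqF ?s_gt0 //; lia.
rewrite /lyness_Xm /invariant /direction; cbv zeta.
rewrite !coord_window; [|lia..].
rewrite sum_window //.
have -> : \prod_(1 <= i < k.+1 | i != m) Defs.coord (window k s) i
    = \prod_(1 <= i < k.+1 | i != m) s i.
  by apply: congr_big_nat => // i ik; rewrite coord_window //; lia.
have -> : \prod_(1 <= i < k | (i != m.-1) && (i != m))
      (1 + Defs.coord (window k s) i + Defs.coord (window k s) i.+1)
    = \prod_(1 <= i < k | (i != m.-1) && (i != m)) consecutive_sum s i.
  by apply: congr_big_nat => // i ik; rewrite !coord_window //; lia.
(* By the relation at index 1, [a + s 1 + ... + s k = s 1 * (1 + s k.+1)]. *)
have -> : a + \sum_(1 <= i < k.+1) s i + s 1%N * s k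
    = s 1%N * consecutive_sum s k.
  rewrite big_ltn; last by lia.
  by move: h1; rewrite /lyness_relation add1n /consecutive_sum => e; ring: e.
have eP : \prod_(1 <= i < k.+1) consecutive_sum s i
  = consecutive_sum s m.-1 * (consecutive_sum s m *
    \prod_(1 <= i < k | (i != m.-1) && (i != m)) consecutive_sum s i)
    * consecutive_sum s k.
  rewrite big_nat_recr /=; last by lia.
  rewrite (bigD1_seq m.-1) ?iota_uniq ?mem_index_iota //=; last by lia.
  congr (_ * _ * _); rewrite big_mkcond.
  rewrite (bigD1_seq m) ?iota_uniq ?mem_index_iota //=; last by lia.
  rewrite ifT; last by lia.
  by congr (_ * _); rewrite -big_mkcondl.
have eQ : s 1%N * \prod_(2 <= i < k.+1) s i
    = s m * \prod_(1 <= i < k.+1 | i != m) s i.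
  rewrite -big_ltn; last by lia.
  by rewrite (bigD1_seq m) ?iota_uniq ?mem_index_iota //=; lia.
rewrite eP.
have Q0 : \prod_(2 <= i < k.+1) s i != 0.
  by apply: prod_nat_neq0 => i ik; apply: s_gt0; lia.
have Q1 : \prod_(1 <= i < k.+1 | i != m) s i != 0.
  apply/eqP => Q1; move/eqP: eQ; rewrite Q1 mulr0 mulf_eq0 (negPf Q0) orbF.
  by apply/negP; rewrite s0 //; lia.
move: eQ Q0 Q1.
set P := \prod_(1 <= _ < k | _) _; set Q := \prod_(1 <= _ < k.+1 | _) _.
set Q' := \prod_(2 <= _ < k.+1) _ => eQ Q0 Q1.
have pm : consecutive_sum s m.-1 != 0 by rewrite p0 //; lia.
have pm1 : consecutive_sum s m != 0 by rewrite p0 //; lia.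
rewrite mulf_div; apply/eqP; rewrite eqr_div ?mulf_neq0 //; apply/eqP.
by ring: eQ.
Qed.

Lemma lyness_Xk_window s :
  (forall i, (i <= k.+1)%N -> 0 < s i) -> lyness_relation k a s 1 ->
  lyness_Xk a (window k s) = invariant k s * direction s k.
Proof.
move=> s_gt0 h1.
have p0 i : (i <= k)%N -> consecutive_sum s i != 0.
  by move=> ik; rewrite gt_eqF // consecutive_sum_gt0 ?s_gt0 //; lia.
have s0 i : (i <= k)%N -> s i != 0 by move=> ?; rewrite gt_eqF ?s_gt0 //; lia.
rewrite /lyness_Xk /invariant /direction; cbv zeta.
rewrite !coord_window; [|lia..].
rewrite sum_window ?prod_window ?prod_consecutive_window //; [|lia..].
(* The third factor of the numerator is [s 1 * (s k.+1 - s k.-1)]. *)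
move: h1; rewrite /lyness_relation add1n => <-.
have eP : \prod_(1 <= i < k.+1) consecutive_sum s i
  = \prod_(1 <= i < k.-1) consecutive_sum s i
    * consecutive_sum s k.-1 * consecutive_sum s k.
  rewrite big_nat_recr /=; last by lia.
  by rewrite -{1}(@prednK k) ?big_nat_recr //=; lia.
have eQ : s 1%N * \prod_(2 <= i < k.+1) s i = \prod_(1 <= i < k) s i * s k.
  rewrite -big_ltn; last by lia.
  by rewrite big_nat_recr //=; lia.
rewrite eP.
have Q0 : \prod_(2 <= i < k.+1) s i != 0.
  by apply: prod_nat_neq0 => i ik; apply: s_gt0; lia.
have Q1 : \prod_(1 <= i < k) s i != 0.
  by apply: prod_nat_neq0 => i ik; apply: s_gt0; lia.
move: eQ Q0 Q1.
set P := \prod_(1 <= _ < k.-1) _; set Q := \prod_(1 <= _ < k) _.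
set Q' := \prod_(2 <= _ < k.+1) _ => eQ Q0 Q1.
have pm : consecutive_sum s k.-1 != 0 by rewrite p0 //; lia.
have pm1 : consecutive_sum s k != 0 by rewrite p0 //; lia.
rewrite mulf_div -mulNr; apply/eqP; rewrite eqr_div ?mulf_neq0 //; apply/eqP.
by ring: eQ.
Qed.

Lemma lyness_field_window s :
  (forall i, (i <= k.+1)%N -> 0 < s i) ->
  lyness_relation k a s 0 -> lyness_relation k a s 1 ->
  lyness_field a (window k s) = invariant k s *: window k (direction s).
Proof.
move=> s_gt0 h0 h1; apply/rowP => i; rewrite !mxE.
case: eqP => [->|/eqP i1]; first exact: lyness_X1_window.
case: eqP => [->|/eqP ik]; first exact: lyness_Xk_window.
by apply: lyness_Xm_window => //; have := ltn_ord i; lia.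
Qed.

Lemma lyness_window s : s 1%N != 0 -> lyness_relation k a s 1 ->
  lyness a (window k s) = window k (seq_shift s).
Proof.
move=> s10 h1; apply/rowP => i; rewrite !mxE; case: ifPn => ik.
  by rewrite coord_window.
have -> : i.+1 = k by have := ltn_ord i; lia.
rewrite coord_window; last by lia.
rewrite sum_window //.
by move: h1; rewrite /lyness_relation add1n => <-; rewrite mulrAC divff ?mul1r.
Qed.

Lemma addr_sum_gt0 s m n : 0 <= a -> (m < n)%N ->
  (forall i, (m <= i < n)%N -> 0 < s i) -> 0 < a + \sum_(m <= i < n) s i.
Proof.
move=> a0 mn s_gt0; rewrite ltr_wpDl // big_ltn // ltr_pwDl ?s_gt0 ?leqnn //.
rewrite big_nat sumr_ge0 // => i /andP[mi ni].
by rewrite ltW // s_gt0 // (ltnW mi).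
Qed.

(** Every point of the orthant is the window of a positive stretch of orbit,
    prolonged by one step to the left and two steps to the right. *)
Lemma orthant_window (x : 'rV[R]_k) : 0 <= a -> positive_orthant R k x ->
  exists s, [/\ x = window k s, forall i, (i <= k.+2)%N -> 0 < s i,
    lyness_relation k a s 0, lyness_relation k a s 1 & lyness_relation k a s 2].
Proof.
move=> a0 x_gt0; pose c := Defs.coord x.
have cE (i : 'I_k) : c i.+1 = x ord0 i.
  by rewrite /c /Defs.coord valK.
have c_gt0 i : (0 < i <= k)%N -> 0 < c i.
  by case: i => // i /= ik; have := x_gt0 (Ordinal ik); rewrite -cE.
pose l := (a + \sum_(1 <= j < k) c j) / c k.
pose r1 := (a + \sum_(2 <= j < k.+1) c j) / c 1%N.
pose r2 := (a + (\sum_(3 <= j < k.+1) c j + r1)) / c 2%N.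
pose s i := if i == 0%N then l else if (i <= k)%N then c i
  else if i == k.+1 then r1 else r2.
have sc i : (0 < i <= k)%N -> s i = c i.
  by rewrite /s; case: i => //= i ->.
have s0 : s 0%N = l by [].
have sk1 : s k.+1 = r1 by rewrite /s /= ltnn eqxx.
have sk2 : s k.+2 = r2.
  by rewrite /s /= ifF ?ifF //; lia.
have sumsc m n : (0 < m)%N -> (n <= k.+1)%N ->
    \sum_(m <= j < n) s j = \sum_(m <= j < n) c j.
  by move=> m0 nk; apply: eq_big_nat => j jk; rewrite sc //; lia.
have r1_gt0 : 0 < r1.
  rewrite divr_gt0 ?c_gt0 //; last by lia.
  by rewrite addr_sum_gt0 //; [lia|move=> i ik; rewrite c_gt0 //; lia].
exists s; split.
- by apply/rowP => i; rewrite mxE sc ?cE // ltn_ord.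
- move=> i ik; rewrite /s; case: eqP => [_|/eqP i0].
    rewrite divr_gt0 ?c_gt0 //; [|lia].
    by rewrite addr_sum_gt0 //; [lia|move=> j jk; rewrite c_gt0 //; lia].
  case: ifP => ik'; first by rewrite c_gt0 //; lia.
  case: eqP => // _; rewrite divr_gt0 ?c_gt0 //; last by lia.
  rewrite addrA addr_gt0 // addr_sum_gt0 // => j jk; rewrite c_gt0 //; lia.
- have ck : c k != 0 by rewrite gt_eqF ?c_gt0 //; lia.
  by rewrite /lyness_relation add0n s0 sumsc // sc ?divfK //; lia.
- have c1 : c 1%N != 0 by rewrite gt_eqF ?c_gt0 //; lia.
  rewrite /lyness_relation add1n sk1 sumsc // sc; last by lia.
  by rewrite mulrC divfK.
- have c2 : c 2%N != 0 by rewrite gt_eqF ?c_gt0 //; lia.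
  rewrite /lyness_relation add2n sk2 big_nat_recr /=; last by lia.
  rewrite sk1 sumsc // sc; last by lia.
  by rewrite mulrC divfK.
Qed.

End LynessSequences.

(** * The differential of the Lyness map *)

Section DifferentiationRules.
Variables (R : realType) (V : normedModType R).
Implicit Types (x : V).

Lemma is_diff_sumr (I : Type) (r : seq I) (f df : I -> V -> R) x :
  (forall i, is_diff x (f i) (df i)) ->
  is_diff x (fun y => \sum_(i <- r) f i y) (fun v => \sum_(i <- r) df i v).
Proof.
move=> fdf; elim: r => [|i r IHr].
  under eq_fun do rewrite big_nil.
  under [X in is_diff_def _ _ X]eq_fun do rewrite big_nil.
  exact: is_diff_cst.
under eq_fun do rewrite big_cons.
under [X in is_diff_def _ _ X]eq_fun do rewrite big_cons.
exact: is_diffD.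
Qed.

Lemma is_diff_div (f g df dg : V -> R) x : g x != 0 ->
  is_diff x f df -> is_diff x g dg ->
  is_diff x (fun y => f y / g y)
    (fun v => (df v - f x / g x * dg v) / g x).
Proof.
move=> gx0 fdf gdg.
have gV : is_diff x (fun y => (g y)^-1) (- (g x) ^- 2 \*: dg).
  apply: DiffDef; first exact: differentiableV.
  by rewrite diffV // diff_val.
apply: (is_diff_eq (is_diffM fdf gV)); apply/funext => v /=.
rewrite /GRing.scale /= !fctE /= /GRing.scale /=.
by field.
Qed.

Lemma is_diff_linear (W : normedModType R) (f : V -> W) x :
  linear f -> continuous f -> is_diff x f f.
Proof.
move=> flin fcont.
pose fM := GRing.isLinear.Build _ _ _ _ _ flin.
pose fL : {linear V -> W} := HB.pack f fM.
apply: DiffDef; first exact: (@linear_differentiable _ _ _ fL).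
by rewrite (@diff_lin _ _ _ fL).
Qed.

End DifferentiationRules.

(** A map into row vectors is differentiable as soon as its entries are, and its
    differential is computed entrywise. *)
Lemma is_diff_row (R : realType) (V : normedModType R) (n : nat)
    (f df : V -> 'rV[R]_n) (x : V) :
  (forall i, is_diff x (fun y => f y ord0 i) (fun v => df v ord0 i)) ->
  is_diff x f df.
Proof.
move=> fdf.
(* [f] is the sum of its entries times the basis vectors. *)
have fx : differentiable f x.
  rewrite (_ : f = \sum_(i < n) fun y => f y ord0 i *: 'e_i); last first.
    by apply/funext => y; rewrite fct_sumE -row_sum_delta.
  apply: differentiable_sum => i; apply: differentiableZl.
  exact: ex_diff.
apply: DiffDef => //; apply/funext => v; apply/rowP => i.
have lin : linear (fun M : 'rV[R]_n => M ord0 i : R).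
  by move=> c M N; rewrite !mxE.
have ci : is_diff (f x) (fun M : 'rV[R]_n => M ord0 i : R) (fun M => M ord0 i).
  by apply: is_diff_linear => //; exact: coord_continuous.
have /(congr1 (@^~ v)) /= := diff_comp fx (@ex_diff _ _ _ _ _ _ _ ci).
rewrite [X in X = _](_ : _ = 'd (fun y => f y ord0 i) x v) //.
by rewrite !diff_val => ->.
Qed.

Section LynessDifferential.
Variables (R : realType) (k : nat) (a : R).
Implicit Types (x v : 'rV[R]_k).

Lemma is_diff_coord j x :
  is_diff x (fun y => Defs.coord y j : R) (fun v => Defs.coord v j).
Proof.
apply: is_diff_linear.
  move=> c y z; case: j => [|j] /=; first by rewrite scaler0 addr0.
  rewrite /Defs.coord; case: insubP => [i _ _|_] /=; first by rewrite !mxE.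
  by rewrite scaler0 addr0.
case: j => [|j]; first exact: cst_continuous.
rewrite /Defs.coord; case: insubP => [i _ _|_] /=; last exact: cst_continuous.
exact: coord_continuous.
Qed.

(** The differential of the Lyness map at [x] applied to [v], the last entry
    being given by the quotient rule. *)
Definition lyness_differential x v : 'rV[R]_k :=
  \row_(i < k)
    if (i.+1 < k)%N then Defs.coord v i.+2
    else (\sum_(2 <= j < k.+1) Defs.coord v j
          - (a + \sum_(2 <= j < k.+1) Defs.coord x j) / Defs.coord x 1
            * Defs.coord v 1) / Defs.coord x 1.

Lemma is_diff_lyness x : Defs.coord x 1 != 0 ->
  is_diff x (lyness a) (lyness_differential x).
Proof.
move=> x1; apply: is_diff_row => i.
under eq_fun do rewrite mxE.
under [X in is_diff_def _ _ X]eq_fun do rewrite mxE.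
case: (i.+1 < k)%N; first exact: is_diff_coord.
apply: (@is_diff_div _ _ (fun y => a + \sum_(2 <= j < k.+1) Defs.coord y j)
   (fun y => Defs.coord y 1)) => //; last exact: is_diff_coord.
have s := is_diff_sumr (index_iota 2 k.+1) (fun j => is_diff_coord j x).
apply: (is_diff_eq (is_diffD (is_diff_cst a x) s)).
by rewrite add0r.
Qed.

Lemma lyness_differential_window (s t : nat -> R) : (3 <= k)%N ->
  s 1%N != 0 -> lyness_relation k a s 1 ->
  s 1%N * t k.+1 + s k.+1 * t 1%N = \sum_(2 <= i < k.+1) t i ->
  lyness_differential (window k s) (window k t) = window k (seq_shift t).
Proof.
move=> hk s10 h1 ht; apply/rowP => i; rewrite !mxE; case: ifPn => ik.
  by rewrite coord_window.
have -> : i.+1 = k by have := ltn_ord i; lia.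
rewrite !coord_window; [|lia..].
rewrite !sum_window // -ht; move: h1; rewrite /lyness_relation add1n => <-.
by rewrite /seq_shift; field.
Qed.

End LynessDifferential.

(** In terms of the differential, the symmetry condition reads
    [X (G x) = 'd G x (X x)]. *)
Lemma lie_symmetryP (R : realType) (k : nat) (U : set 'rV[R]_k)
    (G X : 'rV[R]_k -> 'rV[R]_k) :
  (forall x, U x ->
    [/\ U (G x), differentiable G x & X (G x) = 'd G x (X x)]) ->
  lie_symmetry U G X.
Proof.
move=> GX; split=> x /GX[] // _ _ ->.
by rewrite /jacobian_matrix -trmx_mul /jacobian mul_rV_lin1.
Qed.

Unset Implicit Arguments.

Theorem theorem1 (R : realType) (k : nat) (hk : (3 <= k)%N) (a : R)
    (ha : 0 <= a) :
  lie_symmetry (positive_orthant R k) (lyness a) (lyness_field a).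
Proof.
apply: lie_symmetryP => x /(orthant_window hk ha)[s [-> s_gt0 h0 h1 h2]].
have s_gt0' i : (i <= k.+1)%N -> 0 < s i by move=> ik; apply: s_gt0; lia.
have s10 : s 1%N != 0 by rewrite gt_eqF ?s_gt0.
have dF : is_diff (window k s) (lyness a) (lyness_differential a (window k s)).
  by apply: is_diff_lyness; rewrite coord_window //; lia.
split; [|exact: ex_diff|].
  rewrite lyness_window // => i; rewrite mxE s_gt0' //.
  by have := ltn_ord i; lia.
rewrite lyness_window // !(lyness_field_window (a := a)) //; first last.
- exact: lyness_relation_shift.
- exact: lyness_relation_shift.
- by move=> i ik; apply: s_gt0; lia.
rewrite linearZ /= diff_val (invariant_shift (a := a)) //.
(* The directions of the shifted sequence, from index 1 on, are by definition
   those of [s] shifted; only at index 0 would the predecessor matter. *)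
rewrite lyness_differential_window //.
exact: (linearized_relation (a := a)).
Qed.
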